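(* Let $P_{max}$ be the largest message size that can be sent. For each message $i=1,2,\dots$ of size $x_i$, let the observed transmission time be $$y_i=\beta^{(i)}x_i+\alpha^{(i)},\qquad \alpha^{(i)}=\alpha_{const}+\delta\alpha_i,\quad \beta^{(i)}=\beta_{const}+\delta\beta_i,$$ where $\alpha_{const},\beta_{const}$ are constants (the true values of the coefficients) and the noises $\delta\alpha_i$ and $\delta\beta_i$ follow independent normal distributions with mean $0$ and standard deviations $\alpha_m\cdot\alpha_{const}$ and $\beta_m\cdot\beta_{const}$ respectively. Consider the following algorithm. Initialization: for two message sizes $x_1,x_2$ compute the times $y_1,y_2$, and set $s_x^2=x_1+x_2$, $s_y^2=y_1+y_2$, $s_{xy}^2=x_1y_1+x_2y_2$, $s_{xx}^2=x_1x_1+x_2x_2$ (the superscript is the step index, not a power). For $k=3,4,\dots$: for a new message size $x_k\in[0,P_{max}]$, selected deterministically or randomly, compute the time $y_k$ and set $$s_x^k=s_x^{k-1}+x_k,\quad s_y^k=s_y^{k-1}+y_k,\quad s_{xy}^k=s_{xy}^{k-1}+x_ky_k,\quad s_{xx}^k=s_{xx}^{k-1}+x_kx_k,$$ $$\beta_k=\frac{k\,s_{xy}^k-s_x^k\,s_y^k}{k\,s_{xx}^k-(s_x^k)^2},\qquad \alpha_k=\frac{s_y^k-\beta_k\,s_x^k}{k}.$$ Then $\beta_k$ and $\alpha_k$ are unbiased estimations of $\beta$ and $\alpha$, namely $$\mathbb{E}[\beta_k]=\beta_{const}\quad\text{and}\quad\mathbb{E}[\alpha_k]=\alpha_{cons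t}.$$
   Context: The time to transmit a message of size $x$ over a network is modelled as $T(x)=\alpha+\beta x$, where $\alpha$ is the channel (server) initialization time and $\beta$ is the time to transmit one unit of information. For each message the values of $\alpha$ and $\beta$ are stochastic and vary among samples: each is a constant true value plus centred normal noise whose standard deviation is a multiple ($\alpha_m$, respectively $\beta_m$) of the true value. Messages of sizes from $0$ to $P_{max}$ can be sent. The quantities $\alpha_k,\beta_k$ are the least squares estimates of the coefficients computed online from the first $k$ pairs (size $x_i$, time $y_i$), by updating the four running sums $s_x^k,s_y^k,s_{xy}^k,s_{xx}^k$.
   Formalization: Sizes are taken independent of the noises, the denominator of β_k is assumed nonzero almost surely, and each mean is asserted when the estimate is integrable (shown if denominator^(-1/2) is integrable); otherwise β_k may be undefined or have no mean. *)

(* Defs.v *)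
From HB Require Import structures.
From mathcomp Require Import all_boot all_order all_algebra finmap.
From mathcomp Require Import all_classical all_reals all_analysis.

Set Implicit Arguments.
Unset Strict Implicit.
Unset Printing Implicit Defensive.

Import Order.TTheory GRing.Theory Num.Theory.

Local Open Scope classical_set_scope.
Local Open Scope ring_scope.

(* [normal_prob m 0] is by convention the uniform law on [0, 1]; the normal law
   with standard deviation 0 is the point mass at its mean. *)
Definition normal_law (R : realType) (m s : R) : set R -> \bar R :=
  fun B => if s == 0 then \d_m B else normal_prob m s B.

Definition mutually_independent d (T : measurableType d) (R : realType)
    (P : probability T R) (I : choiceType) (F : I -> set (set T)) : Prop :=
  forall (J : {fset I}) (E : I -> set T),
    (forall j, j \in J -> F j (E j)) ->
    P (\bigcap_(j in [set` J]) E j) = (\prod_(j <- J) P (E j))%E.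

(* Messages are numbered from 1, so index 0 of a sequence is never used.
   The sizes contribute a single sigma-algebra, generated by the whole sequence:
   they may depend on each other (in particular be deterministic), but not on
   the noises. *)
Definition design_noise_sigma d (T : measurableType d) (R : realType)
    (X da db : nat -> T -> R) (j : option (nat + nat)) : set (set T) :=
  match j with
  | None => <<s \bigcup_i preimage_set_system setT (X i.+1) measurable >>
  | Some (inl i) => preimage_set_system setT (da i.+1) measurable
  | Some (inr i) => preimage_set_system setT (db i.+1) measurable
  end.

Definition obs_time (R : realType) (alpha_const beta_const : R)
    (x da db : nat -> R) (i : nat) : R :=
  (beta_const + db i) * x i + (alpha_const + da i).

Section online_estimates.
Variable R : realType.
Implicit Types (u x y : nat -> R) (k : nat).

(* The recursion starts at step 2; the values at steps 0 and 1 are dummies. *)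
Fixpoint running_sum u k : R :=
  match k with
  | S ((S (S _)) as k') => running_sum u k' + u k
  | _ => u 1%N + u 2%N
  end.

Definition s_x x k := running_sum x k.
Definition s_y y k := running_sum y k.
Definition s_xy x y k := running_sum (fun i => x i * y i) k.
Definition s_xx x k := running_sum (fun i => x i * x i) k.

Definition ls_denom x k : R := k%:R * s_xx x k - (s_x x k) ^+ 2.

Definition beta_est x y k : R :=
  (k%:R * s_xy x y k - s_x x k * s_y y k) / ls_denom x k.

Definition alpha_est x y k : R :=
  (s_y y k - beta_est x y k * s_x x k) / k%:R.

End online_estimates.

(* Main.v *)
(* Where D_k != 0, beta_k - beta_const and alpha_k - alpha_const are odd functions
   of the noises, the sizes being fixed: they are the least squares estimates
   computed from the noise parts e_i = db_i x_i + da_i of the observations. The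
   joint law of (sizes, noises) is invariant under (x, a, b) |-> (x, -a, -b),
   because the noises are symmetric and all blocks are independent (cylinders form
   a generating pi-system on which the law is a product). Hence the mean of these
   odd functions, when it exists, equals its opposite.
   For integrability, \sum_i (k x_i - s_x)^2 = k D_k bounds each coefficient of
   beta_k = \sum_i (k x_i - s_x) y_i / D_k by sqrt k / sqrt D_k, and D_k^(-1/2) is
   independent of each noise, whose absolute value has finite mean. *)
Require Import Defs.
From HB Require Import structures.
From mathcomp Require Import all_boot all_order all_algebra finmap.
From mathcomp Require Import all_classical all_reals all_analysis.
From mathcomp Require Import measurable_realfun ring lra.

Set Implicit Arguments.
Unset Strict Implicit.
Unset Printing Implicit Defensive.

Import Order.TTheory GRing.Theory Num.Theory.

Local Open Scope classical_set_scope.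
Local Open Scope ring_scope.

(** * Deterministic algebra and bounds for the least squares formulas *)

Section least_squares_algebra.
Variable R : realType.
Implicit Types (u x y a b : nat -> R) (k : nat).

Lemma running_sumE u k : (2 <= k)%N ->
  running_sum u k = \sum_(i < k) u i.+1.
Proof.
case: k => [//|[//|k]] _; elim: k => [|k IHk].
  by rewrite big_ord_recr big_ord1.
by rewrite big_ord_recr -IHk.
Qed.

(** Expand the squares. Up to the factor [k], the denominator is a variance-like sum of squares,
    which yields both its sign and a bound on each deviation. *)
Lemma sum_ls_deviation_sqr x k : (2 <= k)%N ->
  \sum_(i < k) (k%:R * x i.+1 - s_x x k) ^+ 2 = k%:R * ls_denom x k.
Proof.
move=> k2; rewrite /ls_denom /s_xx /s_x !running_sumE//; set s := \sum_(i < k) x i.+1.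
transitivity (\sum_(i < k) (k%:R ^+ 2 * (x i.+1 * x i.+1) -
    (2 * k%:R * s) * x i.+1 + s ^+ 2)).
  by apply: eq_bigr => i _; ring.
rewrite big_split/= sumrB -!mulr_sumr sumr_const card_ord -/s.
rewrite -(mulr_natl s); ring.
Qed.

Lemma ls_denom_ge0 x k : (2 <= k)%N -> 0 <= ls_denom x k.
Proof.
move=> k2; have k0 : 0 < k%:R :> R by rewrite ltr0n (leq_trans _ k2).
rewrite -(pmulr_rge0 _ k0) -sum_ls_deviation_sqr//.
by rewrite sumr_ge0// => i _; exact: sqr_ge0.
Qed.

(** One square is at most the sum of all the squares; take square roots. *)
Lemma ls_deviation_le x k (i : 'I_k) : (2 <= k)%N ->
  `|k%:R * x i.+1 - s_x x k| <= Num.sqrt k%:R * Num.sqrt (ls_denom x k).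
Proof.
move=> k2; rewrite -sqrtrM ?ler0n// -sum_ls_deviation_sqr// -sqrtr_sqr.
rewrite ler_wsqrtr//.
by rewrite (bigD1 i)//= lerDl sumr_ge0// => j _; exact: sqr_ge0.
Qed.

(** This form is linear in the observations, with weights that depend on the sizes only; the norm
    bound, the oddness and the shift by [be] are all read off it. *)
Lemma beta_estE x y k : (2 <= k)%N ->
  beta_est x y k =
  (\sum_(i < k) (k%:R * x i.+1 - s_x x k) * y i.+1) / ls_denom x k.
Proof.
move=> k2; rewrite /beta_est /s_xy /s_y !(running_sumE _ k2); congr (_ / _).
rewrite !mulr_sumr -sumrB; apply: eq_bigr => i _; ring.
Qed.

Lemma beta_est_norm_le x y k : (2 <= k)%N ->
  `|beta_est x y k| <=
  Num.sqrt k%:R * (Num.sqrt (ls_denom x k))^-1 * \sum_(i < k) `|y i.+1|.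
Proof.
move=> k2; rewrite beta_estE// normrM normfV (ger0_norm (ls_denom_ge0 x k2)).
set D := ls_denom x k; set r := Num.sqrt D.
(* This also holds for [D = 0], where both sides are 0 because the inverse of 0 is 0; hence the
   bound is valid at every sample. *)
have rE : r^-1 = r / D.
  rewrite -[D in RHS]sqr_sqrtr ?ls_denom_ge0// -/r expr2.
  by have [->|r0] := eqVneq r 0; [rewrite mul0r invr0|field].
rewrite rE [X in _ <= X * _]mulrA mulrAC; apply: ler_wpM2r.
  by rewrite invr_ge0 ls_denom_ge0.
rewrite mulr_sumr (le_trans (ler_norm_sum _ _ _))// ler_sum// => i _.
by rewrite normrM ler_wpM2r// ls_deviation_le.
Qed.

Lemma beta_estN x y k : (2 <= k)%N ->
  beta_est x (fun i => - y i) k = - beta_est x y k.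
Proof.
move=> k2; rewrite !beta_estE// -mulNr -sumrN; congr (_ / _).
by apply: eq_bigr => i _; rewrite mulrN.
Qed.

Lemma alpha_estE x y k : (2 <= k)%N ->
  alpha_est x y k = (\sum_(i < k) y i.+1 - beta_est x y k * s_x x k) / k%:R.
Proof. by move=> k2; rewrite /alpha_est {1}/s_y running_sumE. Qed.

Lemma alpha_estN x y k : (2 <= k)%N ->
  alpha_est x (fun i => - y i) k = - alpha_est x y k.
Proof.
by move=> k2; rewrite !alpha_estE// sumrN beta_estN// mulNr -opprD mulNr.
Qed.

(** The sum of the sizes is at most [k%:R * M], so the division by [k] leaves [M] in front of the
    slope; on the sum of the observations it is simply bounded by 1. *)
Lemma alpha_est_norm_le x y k (M : R) : (2 <= k)%N ->
  (forall i, (0 < i)%N -> 0 <= x i <= M) ->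
  `|alpha_est x y k| <= \sum_(i < k) `|y i.+1| + M * `|beta_est x y k|.
Proof.
move=> k2 xM; have k0 : 0 < k%:R :> R by rewrite ltr0n (leq_trans _ k2).
rewrite alpha_estE// normrM normfV (gtr0_norm k0) ler_pdivrMr// mulrDl.
rewrite (le_trans (ler_normB _ _))// lerD//.
  rewrite (le_trans (ler_norm_sum _ _ _))// ler_peMr ?sumr_ge0//.
  by rewrite ler1n (leq_trans _ k2).
rewrite normrM mulrC mulrAC ler_wpM2r//.
rewrite /s_x running_sumE// (le_trans (ler_norm_sum _ _ _))//.
apply: (@le_trans _ _ (\sum_(i < k) M)); last first.
  by rewrite sumr_const card_ord mulr_natr.
by apply: ler_sum => i _; have /andP[x0 ?] := xM i.+1 isT; rewrite ger0_norm.
Qed.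

(** The weights [k%:R * x i.+1 - s_x x k] sum to 0 and, paired with the sizes, give [ls_denom x k].
    Noiseless affine data thus return exactly [be], and linearity adds the estimate of the noise
    part, which is [obs_time 0 0]. *)
Lemma beta_est_obs_time (al be : R) x a b k : (2 <= k)%N ->
  ls_denom x k != 0 ->
  beta_est x (obs_time al be x a b) k = be + beta_est x (obs_time 0 0 x a b) k.
Proof.
move=> k2 D0; rewrite !beta_estE//; apply: (mulIf D0).
rewrite mulrDl !divfK//.
have -> : be * ls_denom x k =
    \sum_(i < k) (k%:R * x i.+1 - s_x x k) * (al + be * x i.+1).
  rewrite /ls_denom /s_xx /s_x !running_sumE//; set s := \sum_(i < k) x i.+1.
  transitivity (\sum_(i < k) (be * k%:R * (x i.+1 * x i.+1) +
      (al * k%:R - be * s) * x i.+1 - al * s)).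
    rewrite !big_split/= -!mulr_sumr sumr_const card_ord -/s.
    rewrite -(mulr_natl (- (al * s))); ring.
  by apply: eq_bigr => i _; ring.
by rewrite -big_split/=; apply: eq_bigr => i _; rewrite /obs_time; ring.
Qed.

(** In the sum of the observations the term [be * s_x x k] cancels against the true slope contained
    in the estimated one. *)
Lemma alpha_est_obs_time (al be : R) x a b k : (2 <= k)%N ->
  ls_denom x k != 0 ->
  alpha_est x (obs_time al be x a b) k =
  al + alpha_est x (obs_time 0 0 x a b) k.
Proof.
move=> k2 D0; have k0 : k%:R != 0 :> R by rewrite pnatr_eq0 -lt0n (leq_trans _ k2).
rewrite !alpha_estE// beta_est_obs_time//.
have -> : \sum_(i < k) obs_time al be x a b i.+1 =
    k%:R * al + be * s_x x k + \sum_(i < k) obs_time 0 0 x a b i.+1.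
  rewrite /s_x running_sumE// mulr_sumr.
  have -> : k%:R * al = \sum_(i < k) al by rewrite sumr_const card_ord mulr_natl.
  by rewrite -!big_split/=; apply: eq_bigr => i _; rewrite /obs_time; ring.
by field.
Qed.

Lemma obs_time0N x a b :
  obs_time 0 0 x (fun i => - a i) (fun i => - b i) =
  (fun i => - obs_time 0 0 x a b i).
Proof. by apply/funext => i; rewrite /obs_time; ring. Qed.

Lemma obs_time_norm_le (al be : R) x a b (M : R) i : 0 <= x i <= M ->
  `|obs_time al be x a b i| <= M * `|b i| + `|a i| + (M * `|be| + `|al|).
Proof.
move=> /andP[x0 xM]; rewrite /obs_time (le_trans (ler_normD _ _))//.
rewrite addrACA lerD ?(addrC `|a i|) ?ler_normD// -mulrDr normrM mulrC.
by rewrite (ger0_norm x0) ler_pM// addrC ler_normD.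
Qed.

End least_squares_algebra.

(** * Measurability of the estimates *)

Section measurable_least_squares.
Context d (V : measurableType d) (R : realType).

Lemma measurable_invr : measurable_fun setT (@GRing.inv R).
Proof.
(* Squaring makes the base of the real power nonnegative; at 0 both sides are 0. *)
rewrite (_ : GRing.inv = fun x : R => x * (x ^+ 2) `^ (-1)).
  apply: measurable_funM => //.
  have m2 : measurable_fun setT (fun x : R => x ^+ 2) by [].
  exact: (measurableT_comp (measurable_powR (-1)) m2).
apply/funext => x; rewrite powR_inv1 ?sqr_ge0//.
by have [->|x0] := eqVneq x 0; [rewrite invr0 mul0r|field].
Qed.

Lemma measurable_sqrt : measurable_fun setT (@Num.sqrt R).
Proof. apply: continuous_measurable_fun; exact: sqrt_continuous. Qed.

Variables (k : nat) (k2 : (2 <= k)%N).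

Lemma measurable_running_sum (u : V -> nat -> R) :
  (forall i, (i < k)%N -> measurable_fun setT (fun v => u v i.+1)) ->
  measurable_fun setT (fun v => running_sum (u v) k).
Proof.
move=> mu; under eq_fun do rewrite running_sumE//.
by apply: measurable_sum => i; exact: mu.
Qed.

Variables (x y : V -> nat -> R).
Hypothesis mx : forall i, (i < k)%N -> measurable_fun setT (fun v => x v i.+1).

Lemma measurable_ls_denom : measurable_fun setT (fun v => ls_denom (x v) k).
Proof.
apply: measurable_funB.
  apply: measurable_funM => //; apply: measurable_running_sum => i ik.
  by apply: measurable_funM; exact: mx.
by apply: measurable_funX; exact: measurable_running_sum.
Qed.

Lemma measurable_inv_sqrt_denom :
  measurable_fun setT (fun v => (Num.sqrt (ls_denom (x v) k))^-1).
Proof.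
apply: (measurableT_comp measurable_invr).
exact: (measurableT_comp measurable_sqrt measurable_ls_denom).
Qed.

Hypothesis my : forall i, (i < k)%N -> measurable_fun setT (fun v => y v i.+1).

Lemma measurable_beta_est :
  measurable_fun setT (fun v => beta_est (x v) (y v) k).
Proof.
apply: measurable_funM; last first.
  by apply: measurableT_comp measurable_ls_denom; exact: measurable_invr.
apply: measurable_funB; apply: measurable_funM => //;
  apply: measurable_running_sum => // i ik.
by apply: measurable_funM; [exact: mx|exact: my].
Qed.

Lemma measurable_alpha_est :
  measurable_fun setT (fun v => alpha_est (x v) (y v) k).
Proof.
apply: measurable_funM => //; apply: measurable_funB.
  exact: measurable_running_sum.
by apply: measurable_funM; [exact: measurable_beta_est|exact: measurable_running_sum].
Qed.

End measurable_least_squares.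

(** * Centred normal laws: symmetry and finite first absolute moment *)

Section normal_law.
Variable R : realType.
Local Notation mu := (@lebesgue_measure R).

(** The centred density is even and Lebesgue measure is invariant under negation. *)
Lemma normal_probN (s : R) (B : set R) : s != 0 -> measurable B ->
  normal_prob 0 s (-%R @^-1` B) = normal_prob 0 s B.
Proof.
move=> s0 mB; rewrite /normal_prob.
have mpdf : measurable_fun setT (fun x : R => (normal_pdf 0 s x)%:E).
  by apply/measurable_EFinP; exact: measurable_normal_pdf.
transitivity (\int[pushforward mu (-%R : _ -> measurableTypeR R)]_(x in B)
    (normal_pdf 0 s x)%:E)%E.
  rewrite ge0_integral_pushforward//=; last 2 first.
  - exact: measurable_funTS.
  - by move=> x _; rewrite lee_fin normal_pdf_ge0.
  apply: eq_integral => x _ /=; congr EFin.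
  by rewrite !normal_pdfE//= /normal_fun !subr0 sqrrN.
by apply: eq_measure_integral => A mA _; exact: lebesgue_measureN.
Qed.

Lemma normal_lawN (s : R) (B : set R) : measurable B ->
  normal_law 0 s (-%R @^-1` B) = normal_law 0 s B.
Proof.
move=> mB; rewrite /normal_law; case: ifPn => [_|s0]; last exact: normal_probN.
rewrite !diracE; congr (_%:R%:E).
by congr nat_of_bool; apply/idP/idP; rewrite !inE/= oppr0.
Qed.

(** The Radon-Nikodym derivative of [normal_prob 0 s] and [normal_pdf 0 s] have the same integral
    over every measurable set, so they agree almost everywhere. *)
Lemma ge0_integral_normal_prob (s : R) (f : R -> \bar R) : s != 0 ->
  measurable_fun setT f -> (forall x, 0 <= f x)%E ->
  (\int[normal_prob 0 s]_x f x = \int[mu]_x (f x * (normal_pdf 0 s x)%:E))%E.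
Proof.
move=> s0 mf f0.
have dom : normal_prob 0 s `<< mu by exact: normal_prob_dominates.
rewrite -(Radon_Nikodym_SigmaFinite.change_of_variables dom)//.
apply: ae_eq_integral => //.
- apply: emeasurable_funM => //.
  exact: measurable_int (Radon_Nikodym_SigmaFinite.f_integrable dom).
- by apply: emeasurable_funM => //; apply/measurable_EFinP; exact: measurable_normal_pdf.
- apply: ae_eqe_mul2l; apply: integral_ae_eq => //.
  + exact: Radon_Nikodym_SigmaFinite.f_integrable.
  + by apply/measurable_EFinP; exact: measurable_normal_pdf.
  + by move=> E _ mE; rewrite -Radon_Nikodym_SigmaFinite.f_integral.
Qed.

(** Doubling the variance halves the exponent, and the spare exponential factor absorbs [|x|]. The
    right-hand side is a multiple of a density, so its integral is known; the quotient of peaks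
    exchanges the two normalizing constants. *)
Lemma normr_normal_pdf_le (s x : R) : s != 0 ->
  `|x| * normal_pdf 0 s x <=
  2 * `|s| * normal_peak s / normal_peak (Num.sqrt 2 * s) *
  normal_pdf 0 (Num.sqrt 2 * s) x.
Proof.
move=> s0; have s'0 : Num.sqrt 2 * s != 0 by rewrite mulf_neq0// sqrtr_eq0 -ltNge.
rewrite !normal_pdfE//=.
rewrite [leRHS]mulrA divfK ?gt_eqF ?normal_peak_gt0//.
rewrite mulrCA [leRHS]mulrAC [leRHS]mulrC.
apply: ler_wpM2l; first exact: normal_peak_ge0.
rewrite /normal_fun subr0 exprMn sqr_sqrtr//.
(* With v = |x| / (2 |s|), this is v exp(- v^2) <= 1. *)
set v := `|x| / (2 * `|s|).
have xE : `|x| = 2 * `|s| * v by rewrite /v mulrC divfK// mulf_neq0 ?normr_eq0.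
have v2 : v ^+ 2 = x ^+ 2 / (2 * s ^+ 2 *+ 2).
  rewrite /v exprMn exprVn exprMn !real_normK ?num_real//.
  by congr (_ / _); rewrite -mulr_natr; ring.
have -> : - x ^+ 2 / (2 * s ^+ 2 *+ 2) = - v ^+ 2 by rewrite v2 mulNr.
have -> : - x ^+ 2 / (s ^+ 2 *+ 2) = - v ^+ 2 - v ^+ 2.
  by rewrite v2; field.
rewrite expRD xE -[leLHS]mulrA ler_wpM2l ?mulr_ge0// mulrA ler_piMl ?expR_ge0//.
have v_le : v <= expR (v ^+ 2).
  rewrite (le_trans _ (expR_ge1Dx _))// -subr_ge0.
  (* Here [1 + v ^+ 2 - v] is [(v - 2^-1) ^+ 2] plus 3/4. *)
  by have := sqr_ge0 (v - 2^-1); nra.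
by rewrite expRN ler_pdivrMr ?expR_gt0// mul1r.
Qed.

Lemma normr_normal_prob_lty (s : R) : s != 0 ->
  (\int[normal_prob 0 s]_x `|x|%:E < +oo)%E.
Proof.
move=> s0; rewrite ge0_integral_normal_prob//; last exact/measurable_EFinP.
set c := 2 * `|s| * normal_peak s / normal_peak (Num.sqrt 2 * s).
have c0 : 0 <= c by rewrite !mulr_ge0 ?invr_ge0 ?normal_peak_ge0.
apply: (@le_lt_trans _ _
    (\int[mu]_x (c%:E * (normal_pdf 0 (Num.sqrt 2 * s) x)%:E)))%E.
  apply: ge0_le_integral => //.
  - by move=> x _; rewrite -EFinM lee_fin mulr_ge0 ?normal_pdf_ge0.
  - apply: emeasurable_funM; apply/measurable_EFinP => //.
    exact: measurable_normal_pdf.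
  - by apply: emeasurable_funM => //; apply/measurable_EFinP; exact: measurable_normal_pdf.
  - by move=> x _; rewrite -!EFinM lee_fin normr_normal_pdf_le.
rewrite ge0_integralZl//; last first.
- by move=> x _; rewrite lee_fin normal_pdf_ge0.
- by apply/measurable_EFinP; exact: measurable_normal_pdf.
by rewrite integral_normal_pdf mule1 ltry.
Qed.

Lemma integrable_normal_law d (T : measurableType d) (P : probability T R)
    (Y : {RV P >-> R}) (s : R) :
  (forall B, measurable B -> distribution P Y B = normal_law 0 s B) ->
  P.-integrable setT (EFin \o Y).
Proof.
move=> lawY; apply/integrableP; split; first exact/measurable_EFinP.
have mY : measurable_fun setT (Y : T -> measurableTypeR R).
  by move=> mT A mA; exact: (measurable_funP Y mT A mA).
(* [Y'] is the same function as [Y], with its codomain retyped so that its law can be compared with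
   the measures below. *)
pose Y' : {mfun T >-> measurableTypeR R} :=
  HB.pack (Y : T -> measurableTypeR R) (isMeasurableFun.Build _ _ _ _ _ mY).
have mn : measurable_fun setT (fun x : measurableTypeR R => `|x|%:E).
  exact/measurable_EFinP.
have -> : (\int[P]_w `|(EFin \o Y) w| = \int[distribution P Y']_x `|x|%:E)%E.
  by rewrite ge0_integral_distribution.
have [s0|s0] := eqVneq s 0.
  rewrite (eq_measure_integral (dirac (0 : measurableTypeR R))); last first.
    by move=> A mA _; have := lawY A mA; rewrite /normal_law s0 eqxx.
  by rewrite integral_dirac// diracT mul1e ltry.
rewrite (eq_measure_integral (normal_prob 0 s)); last first.
  by move=> A mA _; have := lawY A mA; rewrite /normal_law (negbTE s0).
exact: normr_normal_prob_lty.
Qed.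

End normal_law.

(** * Products of independent integrable variables *)

Section independence.
Context d (T : measurableType d) (R : realType) (P : probability T R).

(** The joint law agrees with the product of the marginals on rectangles, hence everywhere; Tonelli
    then factors the mean of [|U V|] into two finite means. *)
Lemma integrable_indepM (U V : {RV P >-> R}) :
  (forall A B, measurable A -> measurable B ->
    P (U @^-1` A `&` V @^-1` B) = P (U @^-1` A) * P (V @^-1` B))%E ->
  P.-integrable setT (EFin \o U) -> P.-integrable setT (EFin \o V) ->
  P.-integrable setT (EFin \o (fun w => U w * V w)).
Proof.
move=> indUV iU iV; apply/integrableP; split.
  by apply/measurable_EFinP; exact: measurable_funM.
have mUV : measurable_fun setT (fun w => (U w, V w)).
  exact: measurable_fun_pair.
pose UV : {mfun T >-> (R * R)%type} :=
  HB.pack (fun w => (U w, V w)) (isMeasurableFun.Build _ _ _ _ _ mUV).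
pose f (z : R * R) : \bar R := (`|z.1 * z.2|)%:E.
have mf : measurable_fun setT f.
  by apply/measurable_EFinP; apply: measurableT_comp => //; exact: measurable_funM.
rewrite [ltLHS](_ : _ = \int[P]_x (f \o UV) x)%E//.
have f0 z : (0 <= f z)%E by rewrite lee_fin.
rewrite -(ge0_integral_distribution UV)//.
rewrite (eq_measure_integral (distribution P U \x distribution P V)%E); last first.
  by move=> A mA _; apply/esym/product_measure_unique.
rewrite fubini_tonelli1//.
have fin (W : {RV P >-> R}) : P.-integrable setT (EFin \o W) ->
    (\int[distribution P W]_x `|x|%:E < +oo)%E.
  move=> /integrableP[_]; rewrite ge0_integral_distribution//.
  exact/measurable_EFinP.
under eq_integral => x _.
  rewrite /fubini_F /f/=; under eq_integral do rewrite normrM EFinM.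
  rewrite ge0_integralZl//; last exact/measurable_EFinP.
  over.
rewrite ge0_integralZr//; last 2 first.
- exact/measurable_EFinP.
- by apply: integral_ge0.
by rewrite lte_mul_pinfty ?fin ?integral_ge0// ge0_fin_numE ?fin ?integral_ge0.
Qed.
End independence.

(** * Sign-flip symmetry of the joint law of sizes and noises, and its consequence for means *)

Section design_and_noise.
Context d (T : measurableType d) (R : realType) (P : probability T R).
Variables (k : nat) (sa sb : R) (X da db : nat -> {RV P >-> R}).
Hypothesis k2 : (2 <= k)%N.
Hypothesis law_da : forall i (B : set R), (0 < i)%N -> measurable B ->
  distribution P (da i) B = normal_law 0 sa B.
Hypothesis law_db : forall i (B : set R), (0 < i)%N -> measurable B ->
  distribution P (db i) B = normal_law 0 sb B.
Local Notation design_noise := (design_noise_sigma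
  (fun i => X i : T -> R) (fun i => da i : T -> R) (fun i => db i : T -> R)).
Hypothesis indep : mutually_independent P design_noise.

(* [measurableTypeR R] is [R] with the base point required by
   [g_sigma_algebraType]. *)
Local Notation W := ((nat -> measurableTypeR R) * (nat -> measurableTypeR R) *
  (nat -> measurableTypeR R))%type.

(** Only messages 1 to [k] are constrained, whence the shift of indices. The sigma-algebra generated
    by these sets sees just the data that enter step [k], so finitely many blocks suffice to
    determine the law. *)
Definition cylinder (A B C : nat -> set R) : set W :=
  [set z | forall i, (i < k)%N ->
    [/\ A i (z.1.1 i.+1), B i (z.1.2 i.+1) & C i (z.2 i.+1)]].

Definition cylinders : set (set W) :=
  [set Z | exists A B C, [/\ forall i, measurable (A i),
     forall i, measurable (B i), forall i, measurable (C i) &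
     Z = cylinder A B C]].

Local Notation WT := (g_sigma_algebraType cylinders).

Lemma cylindersI : setI_closed cylinders.
Proof.
move=> _ _ [A [B [C [mA mB mC ->]]]] [A' [B' [C' [mA' mB' mC' ->]]]].
exists (fun i => A i `&` A' i), (fun i => B i `&` B' i),
  (fun i => C i `&` C' i); split; [by move=> i; exact: measurableI..|].
apply/seteqP; split => z /=.
  by move=> [h h'] i ik; have [? ? ?] := h i ik; have [? ? ?] := h' i ik; split.
by move=> h; split => i ik; have [[? ?] [? ?] [? ?]] := h i ik; split.
Qed.

Lemma cylindersT : cylinders setT.
Proof.
exists (fun=> setT), (fun=> setT), (fun=> setT); split => //.
by apply/seteqP; split.
Qed.

Lemma measurable_coord i : (i < k)%N ->
  [/\ measurable_fun setT (fun z : WT => z.1.1 i.+1),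
      measurable_fun setT (fun z : WT => z.1.2 i.+1) &
      measurable_fun setT (fun z : WT => z.2 i.+1)].
Proof.
(* A condition on one coordinate is itself a cylinder, with [setT] in every other slot. *)
move=> ik; pose at_i (A : set R) j := if j == i then A else setT.
have mat A : measurable A -> forall j, measurable (at_i A j).
  by move=> mA j; rewrite /at_i; case: ifP.
have at_iT A j y : (j == i -> A y) -> at_i A j y.
  by rewrite /at_i; case: ifP => // _; exact.
split=> _ A mA; rewrite setTI; apply: sub_sigma_algebra.
- exists (at_i A), (fun=> setT), (fun=> setT); split => //; first exact: mat.
  apply/seteqP; split => z /= h => [j jk|].
    by split => //; apply: at_iT => /eqP ->.
  by have [] := h i ik; rewrite /at_i eqxx.
- exists (fun=> setT), (at_i A), (fun=> setT); split => //; first exact: mat.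
  apply/seteqP; split => z /= h => [j jk|].
    by split => //; apply: at_iT => /eqP ->.
  by have [] := h i ik; rewrite /at_i eqxx.
- exists (fun=> setT), (fun=> setT), (at_i A); split => //; first exact: mat.
  apply/seteqP; split => z /= h => [j jk|].
    by split => //; apply: at_iT => /eqP ->.
  by have [] := h i ik; rewrite /at_i eqxx.
Qed.

Lemma measurable_trajectory (x a b : nat -> T -> R) :
  (forall i, measurable_fun setT (x i)) ->
  (forall i, measurable_fun setT (a i)) ->
  (forall i, measurable_fun setT (b i)) ->
  measurable_fun setT (fun w => (x^~ w, a^~ w, b^~ w) : WT).
Proof.
move=> mx ma mb; apply: (@measurability _ _ T WT setT _ cylinders erefl).
move=> _ [_ [A [B [C [mA mB mC ->]]]] <-]; rewrite setTI.
rewrite (_ : _ @^-1` _ = \bigcap_(i in `I_k)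
    (x i.+1 @^-1` A i `&` a i.+1 @^-1` B i `&` b i.+1 @^-1` C i)).
  apply: bigcap_measurableType => i _.
  by apply: measurableI; [apply: measurableI|]; rewrite -[X in measurable X]setTI;
    [exact: mx|exact: ma|exact: mb].
apply/seteqP; split => w /= h i ik; first by have [] := h i ik.
by have [[]] := h i ik.
Qed.

Let mZ : measurable_fun setT
  (fun w => (fun i => X i w, fun i => da i w, fun i => db i w) : WT).
Proof. exact: measurable_trajectory. Qed.

Let mZN : measurable_fun setT
  (fun w => (fun i => X i w, fun i => - da i w, fun i => - db i w) : WT).
Proof.
by apply: measurable_trajectory => // i; exact: measurable_funN.
Qed.

Definition trajectory : {mfun T >-> WT} :=
  HB.pack (fun w => (fun i => X i w, fun i => da i w, fun i => db i w) : WT)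
    (isMeasurableFun.Build _ _ _ _ _ mZ).

Definition flipped_trajectory : {mfun T >-> WT} :=
  HB.pack (fun w => (fun i => X i w, fun i => - da i w, fun i => - db i w) : WT)
    (isMeasurableFun.Build _ _ _ _ _ mZN).

(** The finite family of blocks to which mutual independence is applied: the whole design, then the
    [2 k] noises of the first [k] messages. *)
Definition first_indices : {fset option (nat + nat)} :=
  [fset j in None :: [seq Some (inl i) | i <- iota 0 k]
                  ++ [seq Some (inr i) | i <- iota 0 k]]%fset.

Lemma bigcap_first_indices (E : option (nat + nat) -> set T) :
  \bigcap_(j in [set` first_indices]) E j =
  [set w | E None w /\
     forall i, (i < k)%N -> E (Some (inl i)) w /\ E (Some (inr i)) w].
Proof.
apply/seteqP; split => w /=.
  move=> h; split; first by apply: h; rewrite /= !inE.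
  move=> i ik; split; apply: h; rewrite /= !inE/=; apply/orP.
    by left; apply/mapP; exists i; rewrite ?mem_iota.
  by right; apply/mapP; exists i; rewrite ?mem_iota.
move=> [h0 h] j; rewrite /= !inE => /orP[/eqP ->//|].
move=> /orP[] /mapP[i]; rewrite mem_iota add0n => /= ik ->.
  by have [] := h i ik.
by have [] := h i ik.
Qed.

Definition design_event (A : nat -> set R) : set T :=
  [set w | forall i, (i < k)%N -> A i (X i.+1 w)].

(** A joint condition on the sizes belongs to the single block [None], so it counts as one factor
    however the sizes depend on each other. *)
Lemma design_event_sigma (A : nat -> set R) :
  (forall i, measurable (A i)) -> design_noise None (design_event A).
Proof.
move=> mA; pose G := \bigcup_i preimage_set_system setT (X i.+1) measurable.
rewrite (_ : design_event A = \bigcap_(i in `I_k) X i.+1 @^-1` A i)//.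
apply: (@bigcap_measurableType _ (g_sigma_algebraType G)) => i _.
apply: sub_sigma_algebra; exists i => //; exists (A i) => //.
by rewrite setTI.
Qed.

Lemma distribution_flip (A : set W) : (measurable : set (set WT)) A ->
  distribution P trajectory A = distribution P flipped_trajectory A.
Proof.
move=> mA; apply: (@measure_unique _ R WT cylinders (fun=> setT) erefl cylindersI) => //.
- by move=> _; exact: cylindersT.
- by rewrite bigcup_const.
- move=> _ [Ax [Aa [Ab [mAx mAa mAb ->]]]].
  (* The sign map [s] is [idfun] for one law and [-%R] for the other. The two products then share
     the design factor, and their noise factors agree by [normal_lawN]. *)
  pose E (s : R -> R) (j : option (nat + nat)) : set T :=
    match j with
    | None => design_event Ax
    | Some (inl i) => (fun w => s (da i.+1 w)) @^-1` Aa i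
    | Some (inr i) => (fun w => s (db i.+1 w)) @^-1` Ab i
    end.
  have EE s : \bigcap_(j in [set` first_indices]) E s j =
      (fun w => ((fun i => X i w, fun i => s (da i w), fun i => s (db i w)) : W))
        @^-1` cylinder Ax Aa Ab.
    rewrite bigcap_first_indices; apply/seteqP; split => w /=.
      by move=> [h h'] i ik; have [? ?] := h' i ik; split => //; exact: h.
    move=> h; split => [i ik|i ik]; first by have [] := h i ik.
    by have [] := h i ik.
  have mE s j : measurable_fun setT s -> design_noise j (E s j).
    move=> ms; case: j => [[i|i]|]; last exact: design_event_sigma.
      by exists (s @^-1` Aa i); rewrite ?setTI// -[X in measurable X]setTI; exact: ms.
    by exists (s @^-1` Ab i); rewrite ?setTI// -[X in measurable X]setTI; exact: ms.
  transitivity (P (\bigcap_(j in [set` first_indices]) E idfun j)).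
    by rewrite EE.
  transitivity (P (\bigcap_(j in [set` first_indices]) E -%R j)); last first.
    by rewrite EE.
  rewrite !indep => [|j _|j _]; [|apply: mE; exact: oppr_measurable|apply: mE; exact: measurable_id].
  apply: eq_bigr => -[[i|i]|] _ //=.
    rewrite -[LHS]/(distribution P (da i.+1) (Aa i)).
    rewrite -[RHS]/(distribution P (da i.+1) (-%R @^-1` Aa i)).
    rewrite !law_da// ?normal_lawN//.
    by rewrite -[X in measurable X]setTI; exact: oppr_measurable.
  rewrite -[LHS]/(distribution P (db i.+1) (Ab i)).
  rewrite -[RHS]/(distribution P (db i.+1) (-%R @^-1` Ab i)).
  rewrite !law_db// ?normal_lawN//.
  by rewrite -[X in measurable X]setTI; exact: oppr_measurable.
- by move=> _; rewrite -[ltLHS]/(P setT) probability_setT ltry.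
Qed.

Lemma expectation_odd (h : WT -> R) : measurable_fun setT h ->
  (forall x a b, h (x, fun i => - a i, fun i => - b i) = - h (x, a, b)) ->
  P.-integrable setT (EFin \o (h \o trajectory)) ->
  (\int[P]_w (h (trajectory w))%:E = 0)%E.
Proof.
move=> mh hN ih.
have hNE w : h (flipped_trajectory w) = - h (trajectory w) by rewrite -hN.
have mEh : measurable_fun setT (EFin \o h) by exact/measurable_EFinP.
have ihN : P.-integrable setT ((EFin \o h) \o flipped_trajectory).
  apply: eq_integrable (integrableN ih) => // w _ /=.
  by rewrite hNE EFinN.
have fin : (\int[P]_w (h (trajectory w))%:E)%E \is a fin_num.
  exact: integrable_fin_num ih.
have : (\int[P]_w (h (trajectory w))%:E =
    - \int[P]_w (h (trajectory w))%:E)%E.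
  rewrite -[LHS](integral_distribution (X := trajectory) mEh)//.
  rewrite (eq_measure_integral (distribution P flipped_trajectory)); last first.
    by move=> A mA _; exact: distribution_flip.
  rewrite integral_distribution// -integralN/=; last first.
    exact: integrable_add_def.
  by apply: eq_integral => w _ /=; rewrite hNE EFinN.
(* Being its own opposite forces the value 0 once the integral is known to be finite. *)
rewrite -(fineK fin) -EFinN => -[/eqP]; rewrite -addr_eq0 -mulr2n mulrn_eq0/=.
by move=> /eqP ->.
Qed.

(** The estimator is abstract so that slope and intercept are treated together: oddness in the
    observations and a shift by [c] where the denominator is nonzero are what the symmetry argument
    uses. *)
Lemma expectation_estimator (est : (nat -> R) -> (nat -> R) -> nat -> R)
    (al be c : R) :
  (forall x y, est x (fun i => - y i) k = - est x y k) ->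
  (forall x a b, ls_denom x k != 0 -> est x (obs_time al be x a b) k =
     c + est x (obs_time 0 0 x a b) k) ->
  (forall x y : WT -> nat -> R,
    (forall i, (i < k)%N -> measurable_fun setT (fun z => x z i.+1)) ->
    (forall i, (i < k)%N -> measurable_fun setT (fun z => y z i.+1)) ->
    measurable_fun setT (fun z => est (x z) (y z) k)) ->
  let x w := fun i => X i w in
  let y w := obs_time al be (x w) (fun i => da i w) (fun i => db i w) in
  {ae P, forall w, ls_denom (x w) k != 0} ->
  P.-integrable setT (EFin \o (fun w => est (x w) (y w) k)) ->
  ('E_P[fun w => est (x w) (y w) k] = c%:E)%E.
Proof.
move=> estN estD mest x y D0 iest.
pose D (z : WT) := ls_denom z.1.1 k.
(* [D z / D z] is the indicator of [D z != 0]; it makes [h] odd everywhere. *)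
pose h (z : WT) : R :=
  (est z.1.1 (obs_time al be z.1.1 z.1.2 z.2) k - c) * (D z / D z).
have mx i : (i < k)%N -> measurable_fun setT (fun z : WT => z.1.1 i.+1).
  by move=> /measurable_coord[].
have mD : measurable_fun setT D by exact: measurable_ls_denom.
have mh : measurable_fun setT h.
  apply: measurable_funM.
    apply: measurable_funB => //; apply: mest => // i ik.
    have [m1 m2 m3] := measurable_coord ik; rewrite /obs_time.
    by apply: measurable_funD; [apply: measurable_funM => //|]; exact: measurable_funD.
  apply: measurable_funM => //.
  by apply: measurableT_comp mD; exact: measurable_invr.
have hN x' a b : h (x', fun i => - a i, fun i => - b i) = - h (x', a, b).
  rewrite /h /D/=; have [->|D'0] := eqVneq (ls_denom x' k) 0.
    by rewrite mul0r !mulr0 oppr0.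
  by rewrite !estD// obs_time0N estN -mulNr; congr (_ * _); ring.
have hE w : ls_denom (x w) k != 0 -> est (x w) (y w) k = c + h (trajectory w).
  by move=> Dw; rewrite /h /D/= divff// mulr1 addrC subrK.
have ih : P.-integrable setT (EFin \o (h \o trajectory)).
  (* The factor [D z / D z] is 0 or 1, so [h] is dominated by [|est| + |c|]. *)
  apply: (@le_integrable _ _ _ P setT measurableT _
      (fun w => `|est (x w) (y w) k|%:E + `|c|%:E))%E.
  - by apply/measurable_EFinP; exact: measurableT_comp.
  - move=> w _ /=; rewrite lee_fin/= (ger0_norm (addr_ge0 _ _))//.
    rewrite /h/= normrM (le_trans _ (ler_normB _ _))// ler_piMr//.
    rewrite /D/=; have [->|D'0] := eqVneq (ls_denom (x w) k) 0.
      by rewrite mul0r normr0.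
    by rewrite divff// normr1.
  - apply: integrableD => //; last exact: finite_measure_integrable_cst.
    exact: integrable_norm.
rewrite unlock (ae_eq_integral (fun w => c%:E + (h (trajectory w))%:E)%E)//.
- rewrite integralD//; last exact: finite_measure_integrable_cst.
  by rewrite (expectation_odd mh)// adde0 integral_cst//= probability_setT mule1.
- exact: measurable_int iest.
- by apply: emeasurable_funD => //; exact: measurable_int ih.
- by apply: filterS D0 => w Dw _; rewrite hE.
Qed.

End design_and_noise.

(** * Integrability of the estimates from that of [D^(-1/2)] *)

Section integrable_estimates.
Context d (T : measurableType d) (R : realType) (P : probability T R).
Variables (k : nat) (Pmax sa sb al be : R) (X da db : nat -> {RV P >-> R}).
Hypothesis k2 : (2 <= k)%N.
Hypothesis size_range : forall i w, (0 < i)%N -> 0 <= X i w <= Pmax.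
Hypothesis law_da : forall i (B : set R), (0 < i)%N -> measurable B ->
  distribution P (da i) B = normal_law 0 sa B.
Hypothesis law_db : forall i (B : set R), (0 < i)%N -> measurable B ->
  distribution P (db i) B = normal_law 0 sb B.
Local Notation design_noise := (design_noise_sigma
  (fun i => X i : T -> R) (fun i => da i : T -> R) (fun i => db i : T -> R)).
Hypothesis indep : mutually_independent P design_noise.

Let x w := fun i => X i w.
Let y w := obs_time al be (x w) (fun i => da i w) (fun i => db i w).
Let r w := (Num.sqrt (ls_denom (x w) k))^-1.

Let mr : measurable_fun setT r.
Proof. exact: measurable_inv_sqrt_denom. Qed.

Lemma inv_sqrt_denom_sigma (A : set R) : measurable A ->
  design_noise None (r @^-1` A).
Proof.
move=> mA; pose G := \bigcup_i preimage_set_system setT (X i.+1) measurable.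
have mX i : (i < k)%N ->
    measurable_fun (setT : set (g_sigma_algebraType G)) (X i.+1).
  move=> _ _ B mB; apply: sub_sigma_algebra; exists i => //.
  by exists B.
(* The measurability lemma is applied to [T] equipped with the sigma-algebra generated by the sizes
   alone. *)
have := measurable_inv_sqrt_denom k2 (x := x : g_sigma_algebraType G -> _) mX.
by move=> /(_ measurableT A mA); rewrite setTI.
Qed.

(** Mutual independence for the two blocks [None] and [Some j], since [r] is a function of the
    design. *)
Lemma noise_indep (Y : {RV P >-> R}) (j : nat + nat) :
  (forall B, measurable B -> design_noise (Some j) (Y @^-1` B)) ->
  forall A B, measurable A -> measurable B ->
  (P (r @^-1` A `&` Y @^-1` B) = P (r @^-1` A) * P (Y @^-1` B))%E.
Proof.
move=> sY A B mA mB.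
pose E (o : option (nat + nat)) := if o is Some _ then Y @^-1` B else r @^-1` A.
have := @indep [fset None; Some j]%fset E.
rewrite big_fsetU1 ?inE//= big_seq_fset1 => <-.
  congr (P _); apply/seteqP; split => w /=.
    by move=> [? ?] o; rewrite /= !inE => /orP[] /eqP ->.
  by move=> h; split; [apply: (h None)|apply: (h (Some j))]; rewrite /= !inE eqxx ?orbT.
move=> o; rewrite !inE => /orP[] /eqP -> /=; first exact: inv_sqrt_denom_sigma.
exact: sY.
Qed.

Let c := Pmax * `|be| + `|al|.
Let G w := \sum_(i < k) (Pmax * `|db i.+1 w| + `|da i.+1 w| + c).

Let y_le w : \sum_(i < k) `|y w i.+1| <= G w.
Proof. by apply: ler_sum => i _; apply: obs_time_norm_le; exact: size_range. Qed.

Let integrable_da i : P.-integrable setT (EFin \o da i.+1).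
Proof. by apply: (@integrable_normal_law _ _ _ _ _ sa) => B mB; exact: law_da. Qed.

Let integrable_db i : P.-integrable setT (EFin \o db i.+1).
Proof. by apply: (@integrable_normal_law _ _ _ _ _ sb) => B mB; exact: law_db. Qed.

(** The weight [g] lets one statement serve twice: [g = r] for the bound on the slope, and [g = 1]
    for the extra term in the bound on the intercept. *)
Let integrable_G (g : T -> R) : (forall w, 0 <= g w) ->
  P.-integrable setT (EFin \o g) ->
  (forall i, P.-integrable setT (EFin \o (fun w => g w * da i.+1 w))) ->
  (forall i, P.-integrable setT (EFin \o (fun w => g w * db i.+1 w))) ->
  P.-integrable setT (EFin \o (fun w => g w * G w)).
Proof.
move=> g0 ig iga igb.
apply: (eq_integrable measurableT (fun w => \sum_(i < k)
   (Pmax%:E * `|g w * db i.+1 w|%:E + `|g w * da i.+1 w|%:E + c%:E * (g w)%:E))%E) => //.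
  move=> w _ /=; rewrite /G mulr_sumr -sumEFin; apply: eq_bigr => i _.
  rewrite -!EFinM -!EFinD !normrM (ger0_norm (g0 w)); congr EFin; ring.
apply: integrable_sum => // i _; apply: integrableD => //; last first.
  exact: integrableZl.
apply: integrableD => //; last exact: integrable_norm (iga i).
by apply: integrableZl => //; exact: integrable_norm (igb i).
Qed.

Lemma integrable_ls_estimates : P.-integrable setT (EFin \o r) ->
  P.-integrable setT (EFin \o (fun w => beta_est (x w) (y w) k)) /\
  P.-integrable setT (EFin \o (fun w => alpha_est (x w) (y w) k)).
Proof.
move=> ir.
have r0 w : 0 <= r w by rewrite invr_ge0 sqrtr_ge0.
pose r' : {RV P >-> R} := HB.pack r (isMeasurableFun.Build _ _ _ _ _ mr).
have irG : P.-integrable setT (EFin \o (fun w => r w * G w)).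
  apply: integrable_G => // i.
    apply: (@integrable_indepM _ _ _ P r' (da i.+1)) => //.
    by apply: (@noise_indep _ (inl i)) => B mB; exists B; rewrite ?setTI.
  apply: (@integrable_indepM _ _ _ P r' (db i.+1)) => //.
  by apply: (@noise_indep _ (inr i)) => B mB; exists B; rewrite ?setTI.
have iG : P.-integrable setT (EFin \o G).
  apply: (eq_integrable measurableT (EFin \o (fun w => 1 * G w))).
    by move=> w _ /=; rewrite mul1r.
  apply: integrable_G => //; first exact: finite_measure_integrable_cst.
    by move=> i; under eq_fun do rewrite mul1r.
  by move=> i; under eq_fun do rewrite mul1r.
pose b w := Num.sqrt k%:R * (r w * G w).
have ib : P.-integrable setT (EFin \o b).
  exact: (integrableZl measurableT (Num.sqrt k%:R) irG).
have beta_le w : `|beta_est (x w) (y w) k| <= b w.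
  rewrite (le_trans (beta_est_norm_le _ _ k2))// /b -mulrA ler_wpM2l ?sqrtr_ge0//.
  by rewrite ler_wpM2l.
have mx i : (i < k)%N -> measurable_fun setT (fun w => x w i.+1) by [].
have my i : (i < k)%N -> measurable_fun setT (fun w => y w i.+1).
  move=> _; rewrite /y /obs_time.
  by apply: measurable_funD; [apply: measurable_funM => //|]; exact: measurable_funD.
split.
  apply: (le_integrable measurableT _ _ ib).
    by apply/measurable_EFinP; exact: measurable_beta_est.
  by move=> w _ /=; rewrite lee_fin (le_trans (beta_le w))// ler_norm.
apply: (le_integrable measurableT (g := fun w => ((G w)%:E + Pmax%:E * (b w)%:E)%E)).
- by apply/measurable_EFinP; exact: measurable_alpha_est.
- move=> w _ /=; rewrite lee_fin (le_trans _ (ler_norm _))//.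
  (* The size of message 1 at the sample [w] lies between 0 and [Pmax]. *)
  have Pmax0 : 0 <= Pmax.
    by have /andP[/le_trans + ?] := size_range w (ltn0Sn 0); apply.
  rewrite (le_trans (alpha_est_norm_le _ k2 (M := Pmax) _))//.
    by move=> i; exact: size_range.
  by rewrite lerD// ler_wpM2l.
- by apply: integrableD => //; exact: integrableZl.
Qed.

End integrable_estimates.

Theorem proposition1 (R : realType) (d : measure_display)
    (T : measurableType d) (P : probability T R)
    (Pmax alpha_const beta_const alpha_m beta_m : R)
    (X da db : nat -> {RV P >-> R})
    (sd_alpha_ge0 : 0 <= alpha_m * alpha_const)
    (sd_beta_ge0 : 0 <= beta_m * beta_const)
    (size_range : forall i w, (0 < i)%N -> 0 <= X i w <= Pmax)
    (law_da : forall i (B : set R), (0 < i)%N -> measurable B ->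
       distribution P (da i) B = normal_law 0 (alpha_m * alpha_const) B)
    (law_db : forall i (B : set R), (0 < i)%N -> measurable B ->
       distribution P (db i) B = normal_law 0 (beta_m * beta_const) B)
    (indep : mutually_independent P
       (design_noise_sigma (fun i => X i : T -> R) (fun i => da i : T -> R)
          (fun i => db i : T -> R)))
    (k : nat) (hk : (3 <= k)%N) :
  let x (w : T) := fun i => X i w in
  let y (w : T) := obs_time alpha_const beta_const (x w)
                     (fun i => da i w) (fun i => db i w) in
  let D (w : T) := ls_denom (x w) k in
  let beta_k (w : T) := beta_est (x w) (y w) k in
  let alpha_k (w : T) := alpha_est (x w) (y w) k in
  (* the divisions of step k are almost surely well defined *)
  {ae P, forall w, D w != 0} ->
  [/\ (* unbiasedness, as soon as the expectation exists *)
      P.-integrable setT (EFin \o beta_k) ->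
        ('E_P[beta_k] = beta_const%:E)%E,
      P.-integrable setT (EFin \o alpha_k) ->
        ('E_P[alpha_k] = alpha_const%:E)%E
    & (* both exist if D is bounded away from 0 (e.g. fixed x_1 != x_2, or
         deterministic sizes), and even if only D^(-1/2) is integrable *)
      P.-integrable setT (EFin \o (fun w => (Num.sqrt (D w))^-1)) ->
        P.-integrable setT (EFin \o beta_k) /\
        P.-integrable setT (EFin \o alpha_k)].
Proof.
move=> x y D beta_k alpha_k D0; have k2 : (2 <= k)%N := ltnW hk.
split.
(* Three conditions remain for each estimate: oddness, shift by the true coefficient,
   measurability. *)
- apply: (expectation_estimator k2 law_da law_db indep) D0.
  + by move=> ? ?; exact: beta_estN.
  + by move=> ? ? ?; exact: beta_est_obs_time.
  + by move=> ? ?; exact: measurable_beta_est.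
- apply: (expectation_estimator k2 law_da law_db indep) D0.
  + by move=> ? ?; exact: alpha_estN.
  + by move=> ? ? ?; exact: alpha_est_obs_time.
  + by move=> ? ?; exact: measurable_alpha_est.
- exact: (integrable_ls_estimates _ _ k2 size_range law_da law_db indep).
Qed.
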